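(* Let $K$ be a finite simplicial complex and $L$ a subcomplex of $K$ such that $\mathcal F_{\mathscr G}(K)\searrow^{d}\mathcal F_{\mathscr G}(L)$. Then $K\searrow\!\!\searrow L$.
   Context: Simplicial complexes are finite. A simplicial complex $K$ is a simplicial cone $aL$ if there are a (possibly empty) subcomplex $L$ and a vertex $a$ not in $L$ such that the simplices of $K$ are exactly $\{a\}$, the $\sigma\in L$ and the $\{a\}\cup\sigma$ with $\sigma\in L$. For a vertex $x$ of $K$, $\mathrm{lk}_K(x)=\{\sigma\in K: x\notin\sigma,\ \{x\}\cup\sigma\in K\}$ and $K-x=\{\sigma\in K: x\notin\sigma\}$. The vertex $x$ is dominated by $a$ (dismantlable) in $K$ if $\mathrm{lk}_K(x)$ is a simplicial cone $aK'$ for some subcomplex $K'$. The deletion $K\searrow\!\!\searrow K-x$ of a dismantlable vertex is an elementary strong collapse, and $K\searrow\!\!\searrow L$ means that $L$ is obtained from $K$ by a finite (possibly empty) succession of elementary strong collapses. The face graph $\mathcal F_{\mathscr G}(K)$ is the reflexive graph whose vertices are the nonempty simplices of $K$, with an edge between two simplices iff one contains the other. For a graph $G$ (finite, undirected, no parallel edges, loops allowed), $N_G(x)=\{y: y\sim x\}$; a vertex $x$ is dismantlable if there is a vertex $a\neq x$ with $N_G(x)\subset N_G(a)$. $G\searrow^{d}H$, for a subgraph $H$ of $G$, means: $H$ is the subgraph of $G$ induced by $V(H)$ and one can write $V(G)\setminus V(H)=\{x_1,\dots,x_k\}$ ($k\ge0$, distinct) so that each $x_i$ is dismantlable in the subgraph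 of $G$ induced by $V(H)\cup\{x_i,\dots,x_k\}$. *)

(* Defs.v *)
From mathcomp Require Import all_boot.

Set Implicit Arguments.
Unset Strict Implicit.
Unset Printing Implicit Defensive.

(* Simplices are nonempty, so the empty complex is set0; a complex may use only
   some of the points of V, its vertices being the x with [set x] \in K. *)
Definition simplicial_complex (V : finType) (K : {set {set V}}) : Prop :=
  set0 \notin K /\
  forall s t : {set V}, s \in K -> t \subset s -> t != set0 -> t \in K.

Definition is_cone (V : finType) (K : {set {set V}}) (a : V)
    (L : {set {set V}}) : Prop :=
  [/\ simplicial_complex L,
      [set a] \notin L &
      K = [set a] |: (L :|: [set a |: s | s in L])].

Definition link (V : finType) (K : {set {set V}}) (x : V) : {set {set V}} :=
  [set s in K | (x \notin s) && (x |: s \in K)].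

Definition deletion (V : finType) (K : {set {set V}}) (x : V) : {set {set V}} :=
  [set s in K | x \notin s].

Definition dominated (V : finType) (K : {set {set V}}) (x a : V) : Prop :=
  [set x] \in K /\ exists K' : {set {set V}}, is_cone (link K x) a K'.

Inductive strong_collapse (V : finType) (K : {set {set V}}) :
    {set {set V}} -> Prop :=
| strong_collapse_refl : strong_collapse K K
| strong_collapse_step (M : {set {set V}}) (x a : V) :
    strong_collapse K M -> dominated M x a -> strong_collapse K (deletion M x).

(* Undirected graphs, loops allowed, whose vertices are taken in T. *)
Record graph (T : finType) := Graph {
  gvert : {set T};
  gadj : rel T;
  gadj_sym : symmetric gadj;
  gadj_vert : forall x y, gadj x y -> x \in gvert
}.

Definition neighborhood (T : finType) (G : graph T) (x : T) : {set T} :=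
  [set y | gadj G y x].

Definition graph_dismantlable (T : finType) (G : graph T) (x : T) : Prop :=
  x \in gvert G /\
  exists a : T, [/\ a \in gvert G, a != x &
                    neighborhood G x \subset neighborhood G a].

Section Induced.
Variables (T : finType) (G : graph T) (A : {set T}).

Definition induced_adj : rel T :=
  fun x y => [&& x \in A, y \in A & gadj G x y].

Lemma induced_adj_sym : symmetric induced_adj.
Proof. by move=> x y; rewrite /induced_adj gadj_sym andbCA. Qed.

Lemma induced_adj_vert x y : induced_adj x y -> x \in gvert G :&: A.
Proof. by case/and3P=> xA _ /gadj_vert xG; rewrite inE xG. Qed.

Definition induced : graph T := Graph induced_adj_sym induced_adj_vert.
End Induced.

Definition is_induced_subgraph (T : finType) (H G : graph T) : Prop :=
  gvert H \subset gvert G /\ gadj H =2 gadj (induced G (gvert H)).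

Definition graph_collapse (T : finType) (G H : graph T) : Prop :=
  is_induced_subgraph H G /\
  exists xs : seq T,
    [/\ uniq xs,
        xs =i gvert G :\: gvert H &
        forall (s1 s2 : seq T) (x : T), xs = s1 ++ x :: s2 ->
          graph_dismantlable (induced G (gvert H :|: [set y in x :: s2])) x].

Section FaceGraph.
Variables (V : finType) (K : {set {set V}}).

Definition face_vert : {set {set V}} := [set s in K | s != set0].

Definition face_adj : rel {set V} :=
  fun s t => [&& s \in face_vert, t \in face_vert &
                 (s \subset t) || (t \subset s)].

Lemma face_adj_sym : symmetric face_adj.
Proof. by move=> s t; rewrite /face_adj andbCA orbC. Qed.

Lemma face_adj_vert s t : face_adj s t -> s \in face_vert.
Proof. by case/andP. Qed.

Definition face_graph : graph {set V} := Graph face_adj_sym face_adj_vert.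
End FaceGraph.

(* Main.v *)
Require Import Defs.
From mathcomp Require Import all_boot.

(** Dismantling is traded for a homotopy.  Removing dismantlable faces one by
    one and sending each removed face to a face that dominates it produces self
    maps of the face graph of K, from the identity to a map with values in L,
    all fixing L, in which consecutive maps send comparable faces to comparable
    faces ([graph_collapse_deformation]).  Unlike a dismantling order, such a
    deformation survives the strong collapses of K: if x lies outside L and is
    dominated by a, composing every stage with the retraction of K onto K - x
    that replaces x by a gives a deformation of K - x into L
    ([deformation_deletion]).

    It remains to find a dominated vertex outside L as long as K differs from L.
    If there were none, every stage f of a deformation would satisfy
    f {x} = {x} for each vertex x and s \subset f s for each face s
    ([deformation_rigid]).  Indeed, suppose that the next stage h sends {x} to a
    face with another vertex v.  This face is comparable to f s for every face s
    containing x, and s \subset f s, so the larger of the two faces contains s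
    and v: thus v dominates x.  So h fixes the vertices, and h s contains every
    vertex x of s because it is comparable to f {x} = {x}.  At the last
    stage f s is in L, hence so is s, and K = L.  The theorem follows by
    induction on the number of faces. *)

Set Implicit Arguments.
Unset Strict Implicit.
Unset Printing Implicit Defensive.

(** * Deformations of face graphs *)

Section Deformations.

Variable V : finType.
Implicit Types (K L M : {set {set V}}) (s t : {set V}) (x a v : V).
Implicit Types (f g h : {set V} -> {set V}).

Definition comparable s t := (s \subset t) || (t \subset s).

Lemma comparablexx s : comparable s s.
Proof. by rewrite /comparable subxx. Qed.

Lemma comparableC s t : comparable s t = comparable t s.
Proof. exact: orbC. Qed.

Lemma comparable_set1 x t : t != set0 -> comparable [set x] t -> x \in t.
Proof.
move=> t0; rewrite /comparable sub1set subset1 (negPf t0) orbF.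
by case/orP=> // /eqP ->; rewrite set11.
Qed.

(** Adjacency in the exponential graph of the face graph of K; its loops, the
    case g = f, are the homomorphisms of face graphs. *)
Definition adjacent_maps K f g :=
  forall s t, s \in K -> t \in K -> comparable s t -> comparable (f s) (g t).

(** The last stages of the homotopies that start at the identity of K and fix L.
    The first stage is the identity on K only, since a composite with a
    retraction agrees with the identity only on the smaller complex. *)
Inductive deformation K L : ({set V} -> {set V}) -> Prop :=
| deformation_id f : {in K, f =1 id} -> deformation K L f
| deformation_step g h :
    deformation K L g -> {homo h : s / s \in K} -> {in L, h =1 id} ->
    adjacent_maps K g h -> deformation K L h.

Lemma deformation_homo K L f : deformation K L f -> {homo f : s / s \in K}.
Proof. by case=> [{}f fid s sK|//]; rewrite fid. Qed.

Lemma deformation_fix K L f :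
  L \subset K -> deformation K L f -> {in L, f =1 id}.
Proof. by move=> LK [{}f fid s /(subsetP LK)/fid|]. Qed.

Lemma complex_neq0 K s : simplicial_complex K -> s \in K -> s != set0.
Proof. by case=> K0 _ sK; apply: contraNneq K0 => <-. Qed.

Lemma complex_vertex K s x :
  simplicial_complex K -> s \in K -> x \in s -> [set x] \in K.
Proof.
case=> _ Kdown sK xs; apply: Kdown sK _ _; first by rewrite sub1set.
by apply/set0Pn; exists x; rewrite set11.
Qed.

Lemma complex_setU1 K s t v :
  simplicial_complex K -> t \in K -> s \subset t -> v \in t -> v |: s \in K.
Proof.
case=> _ Kdown tK st vt; apply: Kdown tK _ _.
  by rewrite subUset sub1set vt.
by apply/set0Pn; exists v; rewrite setU11.
Qed.

(** * Dominated vertices and their deletion *)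

(** Decidable form of domination, in terms of the star of x instead of its
    link. *)
Definition star_dominated K x a :=
  [&& [set x] \in K, a != x & [forall s in K, (x \in s) ==> (a |: s \in K)]].

Lemma star_dominatedP K x a :
  reflect [/\ [set x] \in K, a != x &
              forall s, s \in K -> x \in s -> a |: s \in K]
          (star_dominated K x a).
Proof.
apply: (iffP and3P) => -[xK ax star]; split=> //.
  by move=> s sK xs; move/forall_inP: star => /(_ s sK) /implyP; apply.
by apply/forall_inP=> s sK; apply/implyP=> xs; apply: star.
Qed.

(** The base of the cone consists of the faces of the link that avoid a. *)
Lemma star_dominated_dominated K x a :
  simplicial_complex K -> star_dominated K x a -> dominated K x a.
Proof.
move=> cK /star_dominatedP[xK ax star]; have [K0 Kdown] := cK.
split=> //; exists [set s in link K x | a \notin s].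
split.
- split=> [|s t]; first by rewrite !inE (negPf K0).
  rewrite !inE => /andP[/and3P[sK xs xsK] nas] ts t0.
  rewrite (Kdown _ _ sK ts t0) (contra (subsetP ts x) xs).
  rewrite (contra (subsetP ts a) nas) /= andbT.
  by apply: (complex_setU1 cK xsK); rewrite ?setU11 // subsetU // ts orbT.
- by rewrite !inE eqxx andbF.
apply/setP=> s; rewrite inE in_setU1 in_setU.
apply/and3P/idP => [[sK xs xsK]|].
  have [-> //|sa] := eqVneq s [set a].
  have [as_|nas] := boolP (a \in s); last by rewrite !inE sK xs xsK nas.
  apply/orP; right; apply/orP; right; apply/imsetP.
  exists (s :\ a); last by rewrite setD1K.
  have t0 : s :\ a != set0.
    by apply: contraNneq sa => t0; rewrite -(setD1K as_) t0 setU0.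
  rewrite !inE eqxx (negPf xs) !andbF /= andbT.
  rewrite (Kdown _ _ sK (subD1set _ _) t0) /=.
  by apply: (complex_setU1 cK xsK); rewrite ?setU11 // subsetU // subD1set orbT.
case/or3P => [/eqP ->||/imsetP[t]].
- have axK : a |: [set x] \in K by rewrite star ?set11.
  split; first by apply: complex_vertex axK _ => //; rewrite setU11.
    by rewrite inE eq_sym.
  by rewrite setUC.
- by rewrite !inE => /andP[/and3P[]].
- rewrite !inE => /andP[/and3P[tK xt xtK] nat ->].
  have axtK : a |: (x |: t) \in K by rewrite star ?setU11.
  split; last by rewrite setUCA.
    by apply: (complex_setU1 cK axtK); rewrite ?setU11 // setUA subsetUr.
  by rewrite !inE (negPf xt) eq_sym (negPf ax).
Qed.

Lemma deletion_complex K x :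
  simplicial_complex K -> simplicial_complex (deletion K x).
Proof.
case=> K0 Kdown; split=> [|s t]; first by rewrite inE (negPf K0).
rewrite !inE => /andP[sK xs] ts t0.
by rewrite (Kdown s) // (contra (subsetP ts x)).
Qed.

Lemma deletion_proper K x : [set x] \in K -> deletion K x \proper K.
Proof.
move=> xK; apply/properP; split; first by apply/subsetP=> s /setIdP[].
by exists [set x]; rewrite // !inE eqxx andbF.
Qed.

(** The simplicial map that replaces x by a. *)
Definition fold x a s := [set if v == x then a else v | v in s].

Lemma fold_id x a s : x \notin s -> fold x a s = s.
Proof.
move=> xs; rewrite -[RHS]imset_id; apply: eq_in_imset => v vs.
by case: eqP vs xs => [-> ->|].
Qed.

Lemma fold_comparable x a s t :
  comparable s t -> comparable (fold x a s) (fold x a t).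
Proof. by case/orP=> st; apply/orP; [left | right]; apply: imsetS. Qed.

Lemma fold_deletion K x a s : simplicial_complex K -> star_dominated K x a ->
  s \in K -> fold x a s \in deletion K x.
Proof.
move=> cK /star_dominatedP[_ ax star] sK.
have [xs|xs] := boolP (x \in s); last by rewrite fold_id // inE sK.
rewrite inE; apply/andP; split.
  apply: (cK.2 _ _ (star s sK xs)).
    apply/subsetP=> _ /imsetP[v vs ->]; rewrite !inE.
    by case: (v =P x); rewrite ?eqxx // vs orbT.
  by rewrite imset_eq0 (complex_neq0 cK).
apply/imsetP=> -[v _]; case: eqP => [_ xa|vx xv]; last by case: vx.
by rewrite xa eqxx in ax.
Qed.

(** Folding is monotone and fixes L, so it can be applied to all stages. *)
Lemma deformation_deletion K L x a f :
    simplicial_complex K -> star_dominated K x a -> L \subset deletion K x ->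
  deformation K L f -> deformation (deletion K x) L (fold x a \o f).
Proof.
move=> cK xa LD; elim=> [{}f fid|g h _ IH hK hL gh].
  by apply: deformation_id => s /setIdP[sK xs] /=; rewrite fid ?fold_id.
apply: deformation_step IH _ _ _.
- by move=> s /setIdP[sK _]; rewrite fold_deletion ?hK.
- move=> s sL /=; rewrite hL //.
  by case/setIdP: (subsetP LD s sL) => _ /fold_id.
- move=> s t /setIdP[sK _] /setIdP[tK _] st.
  by apply: fold_comparable; apply: gh.
Qed.

(** * Rigidity without dominated vertices *)

(** The two conclusions are proved together: that faces only grow is what turns
    a move of the vertex x into a vertex dominating x, and that vertices stay in
    place is what prevents the faces from losing vertices. *)
Lemma deformation_rigid K L f : simplicial_complex K ->
    (forall x a, [set x] \notin L -> ~~ star_dominated K x a) ->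
  deformation K L f ->
  (forall x, [set x] \in K -> f [set x] = [set x]) /\
  (forall s, s \in K -> s \subset f s).
Proof.
move=> cK nodom; elim=> [{}f fid|g h dg [g1 gsub] hK hL gh].
  by split=> s sK; rewrite fid.
have xh x s : s \in K -> x \in s -> x \in h s.
  move=> sK xs; have xK := complex_vertex cK sK xs.
  apply: comparable_set1; first exact: complex_neq0 (hK _ sK).
  by rewrite -(g1 x xK) gh // /comparable sub1set xs.
split=> [x xK|s sK]; last by apply/subsetP=> x; apply: xh.
have [/hL //|xL] := boolP ([set x] \in L).
apply/eqP; rewrite eqEsubset sub1set xh ?set11 // andbT.
apply/subsetP=> v vh; rewrite inE.
apply: contraNT (nodom x v xL) => vx.
apply/star_dominatedP; split=> // s sK xs.
have: comparable (g s) (h [set x]).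
  by rewrite gh // /comparable sub1set xs orbT.
case/orP=> [gs|hg].
  exact: complex_setU1 (hK _ xK) (subset_trans (gsub s sK) gs) vh.
apply: complex_setU1 (deformation_homo dg sK) (gsub s sK) _ => //.
exact: subsetP hg v vh.
Qed.

Lemma deformation_exists_dominated K L f : simplicial_complex K ->
    simplicial_complex L -> deformation K L f -> {in K, forall s, f s \in L} ->
    ~~ (K \subset L) ->
  exists x a, [set x] \notin L /\ star_dominated K x a.
Proof.
move=> cK cL df fL KL.
have [/existsP[x /existsP[a /andP[xL xa]]]|nodom] :=
  boolP [exists x, exists a, ([set x] \notin L) && star_dominated K x a].
  by exists x, a.
case/subsetP: KL => s sK.
have [] := deformation_rigid cK _ df.
  move=> x a xL; apply: contra nodom => xa.
  by apply/existsP; exists x; apply/existsP; exists a; rewrite xL.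
move=> _ /(_ s sK) sub; apply: (cL.2 _ _ (fL s sK) sub).
exact: complex_neq0 sK.
Qed.

Lemma deformation_strong_collapse K L M f : simplicial_complex M ->
    simplicial_complex L -> L \subset M ->
    deformation M L f -> {in M, forall s, f s \in L} ->
  strong_collapse K M -> strong_collapse K L.
Proof.
have [n] := ubnP #|M|; elim: n => // n IH in M f *; rewrite ltnS => Mn.
move=> cM cL LM df fL KM.
have [ML|ML] := boolP (M \subset L).
  by have -> : L = M by apply/eqP; rewrite eqEsubset LM.
have [x [a [xL xa]]] := deformation_exists_dominated cM cL df fL ML.
have xM : [set x] \in M by case/star_dominatedP: xa.
have LD : L \subset deletion M x.
  apply/subsetP=> s sL; rewrite inE (subsetP LM) //.
  by apply: contra xL; apply: complex_vertex.
apply: (IH (deletion M x) (fold x a \o f)) => //.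
- exact: leq_trans (proper_card (deletion_proper xM)) Mn.
- exact: deletion_complex.
- exact: deformation_deletion.
- move=> s /setIdP[sM _] /=; rewrite fold_id ?fL //.
  by case/setIdP: (subsetP LD _ (fL s sM)).
exact: strong_collapse_step KM (star_dominated_dominated cM xa).
Qed.

(** * From dismantlings to deformations *)

Lemma face_vert_complex K : simplicial_complex K -> face_vert K = K.
Proof.
move=> cK; apply/setP=> s; rewrite inE.
by case sK: (s \in K) => //=; rewrite (complex_neq0 cK sK).
Qed.

Lemma face_dismantlable K (A : {set {set V}}) s : simplicial_complex K ->
    A \subset K -> graph_dismantlable (induced (face_graph K) A) s ->
  exists t, [/\ t \in A, t != s &
    forall u, u \in A -> comparable u s -> comparable u t].
Proof.
move=> cK AK [/=]; rewrite !inE => /andP[_ sA] [t [/=]].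
rewrite inE => /andP[_ tA] ts /subsetP N; exists t; split=> // u uA us.
have := N u; rewrite !inE /= /induced_adj uA sA tA /=.
rewrite /face_adj (face_vert_complex cK) !(subsetP AK) //=.
by move/(_ us).
Qed.

(** Sending each removed face to a face that dominates it.  Each stage must be a
    homomorphism of face graphs for the next stage to be adjacent to it. *)
Lemma graph_collapse_deformation K L : simplicial_complex K ->
    simplicial_complex L -> L \subset K ->
    graph_collapse (face_graph K) (face_graph L) ->
  exists f, deformation K L f /\ {in K, forall s, f s \in L}.
Proof.
move=> cK cL LK [_ [xs [uxs xsE dis]]].
rewrite /= !face_vert_complex // in xsE dis.
(* s1 lists the faces already removed, s2 those still present. *)
suff main (s2 s1 : seq {set V}) : xs = s1 ++ s2 -> exists f,
    [/\ deformation K L f, adjacent_maps K f f &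
        {in K, forall s, f s \in L :|: [set y in s2]}].
  have [|f [df _ fL]] := main [::] xs; first by rewrite cats0.
  by exists f; split=> // s /fL; rewrite !inE orbF.
elim/last_ind: s1 s2 => [|s1 x IH] s2 xsE2.
  exists id; split=> //; first exact: deformation_id.
  by move=> s sK; rewrite !inE -[s2]xsE2 xsE inE sK andbT orbN.
rewrite cat_rcons in xsE2; have [f [df ff fA]] := IH _ xsE2.
set A := L :|: [set y in x :: s2] in fA.
have AK : A \subset K.
  rewrite subUset LK; apply/subsetP=> y; rewrite inE => ys.
  have: y \in xs by rewrite xsE2 mem_cat ys orbT.
  by rewrite xsE => /setDP[].
have [a [aA ax dom]] := face_dismantlable cK AK (dis _ _ _ xsE2).
have xA : x \in A by rewrite !inE eqxx orbT.
have xL : x \notin L.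
  have: x \in xs by rewrite xsE2 mem_cat inE eqxx orbT.
  by rewrite xsE => /setDP[].
pose r s := if s == x then a else s.
have rA s : s \in A -> r s \in A by rewrite /r; case: eqP.
have rid s t : s \in A -> comparable s t -> comparable s (r t).
  by rewrite /r; case: eqP => // -> sA; apply: dom.
have rr s t : s \in A -> t \in A -> comparable s t -> comparable (r s) (r t).
  move=> sA tA st; apply: (rid); first exact: rA.
  by rewrite comparableC; apply: rid => //; rewrite comparableC.
exists (r \o f); split.
- apply: (deformation_step df).
  + by move=> s sK; apply: (subsetP AK); apply: rA; apply: fA.
  + move=> s sL /=; rewrite (deformation_fix LK df) // /r.
    by case: eqP sL xL => // -> ->.
  + by move=> s t sK tK st; apply: rid; [apply: fA | apply: ff].
- by move=> s t sK tK st; apply: rr; rewrite ?fA ?ff.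
- move=> s /fA /rA; rewrite !inE /= /r.
  by case: (f s =P x) => [_|/eqP/negPf ->]; rewrite ?(negPf ax).
Qed.

End Deformations.

Theorem theorem4p3 (V : finType) (K L : {set {set V}})
    (hK : simplicial_complex K) (hL : simplicial_complex L)
    (hLK : L \subset K)
    (hd : graph_collapse (face_graph K) (face_graph L)) :
  strong_collapse K L.
Proof.
have [f [df fL]] := graph_collapse_deformation hK hL hLK hd.
exact: deformation_strong_collapse df fL (strong_collapse_refl K).
Qed.
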